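(* Let $X_1,X_2,\dots$ be independent and identically distributed real random variables with $E[X_1]=0$, $0<\sigma^2:=E[X_1^2]$ (with $\sigma>0$) and $\xi:=E|X_1|^3<\infty$. Let $m\ge1$ be an integer, $p\in(0,1)$, and let $N\sim\mathrm{Binomial}(m,p)$ be independent of the sequence $(X_j)_{j\ge1}$. Put $W:=(mp)^{-1/2}\sum_{j=1}^NX_j$. Then $$d_{\mathcal W}\bigl(\mathcal L(W),N(0,\sigma^2)\bigr)\le\Bigl(\frac{C_{\mathcal W}\,\xi}{\sigma^2}+\sigma\sqrt{\frac{2(1-p)}{\pi}}\Bigr)\frac1{\sqrt{mp}}.$$
   Context: $\mathcal L(Y)$ denotes the distribution of a random variable $Y$; an empty sum is $0$. $d_{\mathcal W}(\mu,\nu):=\sup_h|\int h\,d\mu-\int h\,d\nu|$, the supremum over all $1$-Lipschitz $h:\mathbb R\to\mathbb R$, is the Wasserstein distance of probability measures on $\mathbb R$ with finite first moment. $C_{\mathcal W}$ is a finite absolute constant in the Wasserstein version of the Berry-Esseen theorem, i.e. a constant such that for all $n\ge1$ and all independent random variables $Y_1,\dots,Y_n$ with $E[Y_j]=0$, $E[Y_j^2]>0$, $E|Y_j|^3<\infty$, writing $B_n^2=\sum_{j=1}^nE[Y_j^2]$, one has $d_{\mathcal W}\bigl(\mathcal L(B_n^{-1}\sum_{j=1}^nY_j),N(0,1)\bigr)\le C_{\mathcal W}B_n^{-3}\sum_{j=1}^nE|Y_j|^3$. *)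

(* Defs.v *)
From HB Require Import structures.
From mathcomp Require Import all_boot all_order all_algebra.
From mathcomp Require Import all_classical all_reals all_analysis.
From mathcomp Require Import measurable_realfun.

Set Implicit Arguments.
Unset Strict Implicit.
Unset Printing Implicit Defensive.

Import Order.TTheory GRing.Theory Num.Theory.
Import numFieldNormedType.Exports.

Local Open Scope classical_set_scope.
Local Open Scope ring_scope.

(* Non-measurable sets are excluded: there the library's measures take
   unspecified values. *)
Definition same_law d (T : measurableType d) (R : realType)
    (mu nu : probability T R) : Prop :=
  forall A : set T, measurable A -> mu A = nu A.

Definition mutually_independent d d' (T : measurableType d)
    (T' : measurableType d') (R : realType) (P : probability T R)
    (I : eqType) (X : I -> {RV P >-> T'}) : Prop :=
  forall (s : seq I) (A : I -> set T'), uniq s ->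
    (forall i, measurable (A i)) ->
    P (\bigcap_(i in [set` s]) X i @^-1` A i) =
    (\prod_(i <- s) P (X i @^-1` A i))%E.

Definition sigma_of_family d d' (T : measurableType d)
    (T' : measurableType d') (R : realType) (P : probability T R)
    (I : Type) (X : I -> {RV P >-> T'}) : set (set T) :=
  <<s \bigcup_(i in [set: I]) preimage_set_system setT (X i) measurable >>.

Definition independent_of_family d d1 d2 (T : measurableType d)
    (T1 : measurableType d1) (T2 : measurableType d2) (R : realType)
    (P : probability T R) (N : {RV P >-> T1})
    (I : Type) (X : I -> {RV P >-> T2}) : Prop :=
  forall (A : set T1) (B : set T), measurable A -> sigma_of_family X B ->
    P (N @^-1` A `&` B) = (P (N @^-1` A) * P B)%E.

(* Meant for probability measures with finite first moment, for which both
   integrals are finite for every 1-Lipschitz h. *)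
Definition wasserstein (R : realType) (mu nu : probability R R) : \bar R :=
  ereal_sup [set `| \int[mu]_x (h x)%:E - \int[nu]_x (h x)%:E |%E
            | h in [set h : R -> R | 1.-lipschitz h]].

(* normal_prob lives on measurableTypeR R, whose measurable sets are those of R
   but whose display differs from the canonical one on R. *)
Section normal_law.
Context (R : realType).

Definition normal_law (m s : R) : set R -> \bar R := normal_prob m s.

Let normal_law0 m s : normal_law m s set0 = 0%E.
Proof. exact: (measure0 (normal_prob m s)). Qed.

Let normal_law_ge0 m s A : (0 <= normal_law m s A)%E.
Proof. exact: (measure_ge0 (normal_prob m s)). Qed.

Let normal_law_sigma_additive m s : semi_sigma_additive (normal_law m s).
Proof. exact: (@measure_semi_sigma_additive _ _ _ (normal_prob m s)). Qed.

HB.instance Definition _ m s := isMeasure.Build _ _ _ (normal_law m s)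
  (normal_law0 m s) (normal_law_ge0 m s) (@normal_law_sigma_additive m s).

Let normal_lawT m s : normal_law m s [set: R] = 1%E.
Proof. exact: (probability_setT (normal_prob m s)). Qed.

HB.instance Definition _ m s := Measure_isProbability.Build _ _ _
  (normal_law m s) (normal_lawT m s).

End normal_law.

Section scaled_sums.
Context d (T : measurableType d) (R : realType) (P : probability T R).

Definition scaled_sum (a : R) (n : nat) (Y : 'I_n -> {RV P >-> R}) : T -> R :=
  fun w => a * \sum_(j < n) Y j w.

Lemma measurable_scaled_sum a n (Y : 'I_n -> {RV P >-> R}) :
  measurable_fun setT (scaled_sum a Y).
Proof.
apply: measurable_funM; first exact: measurable_cst.
by apply: measurable_sum => j; exact: measurable_funP.
Qed.

HB.instance Definition _ a n (Y : 'I_n -> {RV P >-> R}) :=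
  isMeasurableFun.Build _ _ _ _ (scaled_sum a Y) (measurable_scaled_sum a Y).

Definition scaled_random_sum (a : R) (N : {RV P >-> nat})
    (X : nat -> {RV P >-> R}) : T -> R :=
  fun w => a * \sum_(j < N w) X j w.

Lemma measurable_scaled_random_sum a N X :
  measurable_fun setT (scaled_random_sum a N X).
Proof.
move=> _ A mA; rewrite setTI.
have -> : scaled_random_sum a N X @^-1` A =
  \bigcup_n (N @^-1` [set n] `&` scaled_sum a (fun j : 'I_n => X j) @^-1` A).
  apply/seteqP; split => [w Aw|w [n _ [/= <-]]]//.
  by exists (N w).
apply: bigcup_measurable => n _; apply: measurableI.
  by rewrite -[X in measurable X]setTI; exact: measurable_funP.
by rewrite -[X in measurable X]setTI; exact: measurable_scaled_sum.
Qed.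

HB.instance Definition _ a N X :=
  isMeasurableFun.Build _ _ _ _ (scaled_random_sum a N X)
    (measurable_scaled_random_sum a N X).

End scaled_sums.

Definition berry_esseen_wasserstein_constant (R : realType) (C : R) : Prop :=
  forall d (T : measurableType d) (P : probability T R) (n : nat)
    (Y : 'I_n -> {RV P >-> R}),
  (0 < n)%N ->
  mutually_independent Y ->
  (forall j, 'E_P[Y j] = 0)%E ->
  (forall j, 0 < 'E_P[fun w => (Y j w ^+ 2)%R])%E ->
  (forall j, 'E_P[fun w => (`|Y j w| ^+ 3)%R] < +oo)%E ->
  let B := Num.sqrt (fine (\sum_(j < n) 'E_P[fun w => (Y j w ^+ 2)%R])%E) in
  (wasserstein (distribution P (scaled_sum B^-1 Y)) (normal_law 0 1) <=
   (C * B ^- 3)%:E * \sum_(j < n) 'E_P[fun w => (`|Y j w| ^+ 3)%R])%E.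

(* Main.v *)
Require Import Defs.
From HB Require Import structures.
From mathcomp Require Import all_boot all_order all_algebra.
From mathcomp Require Import all_classical all_reals all_analysis.
From mathcomp Require Import measurable_realfun ring.

Set Implicit Arguments.
Unset Strict Implicit.
Unset Printing Implicit Defensive.

Import Order.TTheory GRing.Theory Num.Theory.
Import numFieldNormedType.Exports.

Local Open Scope classical_set_scope.
Local Open Scope ring_scope.

(** Condition on N. Since N is independent of the summands, the law of W is the
mixture, with the binomial weights w_k, of the laws of a S_k, where
S_k = X_0 + ... + X_(k-1) and a = 1 / sqrt (m p) ([scaled_random_sum_law]).
Fix a 1-Lipschitz h and let Z be a standard normal variable. Then
E h(W) - E h(sigma Z) is the w-average of the differences
E h(a S_k) - E h(sigma Z), and each of these splits at
E h(a sigma sqrt k Z).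

The first half is the Berry-Esseen bound for S_k / (sigma sqrt k). The
Wasserstein distance is homogeneous under dilations ([wasserstein_scale]); the
bound CW xi / (sigma^3 sqrt k) for the normalized sum gets multiplied by
a sigma sqrt k, so k cancels and a CW xi / sigma^2 remains; for k = 0 the two
terms coincide ([scaled_sum_normal_approx]). The binomial weights add up to one, so this is
also the averaged contribution.

The second half compares two centred normal laws. Dilations of the same Z give a
coupling of them, so the difference is at most
E|Z| |a sigma sqrt k - sigma| = sqrt (2 / pi) sigma |sqrt (k / (m p)) - 1|
([normal_law_lipschitz_scale], [normal_law_abs_moment]). The inequality
|sqrt x - 1| <= |x - 1| removes the root, and the binomial average of
|k / (m p) - 1| is at most the standard deviation sqrt (m p (1 - p)) / (m p) =
sqrt (1 - p) / sqrt (m p) ([binomial_sqrt_deviation]). *)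

(** * Integrals against centred normal laws *)

Section normal.
Context (R : realType).
Local Open Scope ereal_scope.

(** [normal_law] and [normal_prob] live on two copies of the Borel space of R with
different displays; integrals are carried from one to the other along the
identity. *)
Let idTR : measurableTypeR R -> R := idfun.

#[local] HB.instance Definition _ :=
  @isMeasurableFun.Build _ _ _ _ idTR (@measurable_id _ _ setT).

(** The density is a Radon-Nikodym derivative of the normal law, hence almost
everywhere equal to the chosen one, for which change of variables holds. *)
Lemma normal_law_density (s : R) (f : R -> R) :
  (forall x, (0 <= f x)%R) -> measurable_fun [set: R] f ->
  \int[normal_law 0 s]_x (f x)%:E =
  \int[lebesgue_measure]_x (f x * normal_pdf 0 s x)%:E.
Proof.
move=> f0 /measurable_EFinP mf.
have {}f0 x : 0 <= (f x)%:E by rewrite lee_fin.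
under [RHS]eq_integral do rewrite EFinM.
have dom := @normal_prob_dominates R 0 s.
have -> : \int[normal_law 0 s]_x (f x)%:E = \int[normal_prob 0 s]_x (f x)%:E.
  transitivity (\int[pushforward (normal_prob 0 s) idTR]_x (f x)%:E).
    exact: eq_measure_integral.
  by rewrite ge0_integral_pushforward.
rewrite -(Radon_Nikodym_SigmaFinite.change_of_variables dom)//.
have mpdf : measurable_fun [set: measurableTypeR R]
    (fun x => (normal_pdf 0 s x)%:E).
  by apply/measurable_EFinP; exact: measurable_normal_pdf.
have intRN := Radon_Nikodym_SigmaFinite.f_integrable dom.
apply: ae_eq_integral => //.
- apply: emeasurable_funM => //; exact: (measurable_int _ intRN).
- exact: emeasurable_funM.
- apply: ae_eqe_mul2l; apply: integral_ae_eq => //.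
  by move=> E _ mE; rewrite -Radon_Nikodym_SigmaFinite.f_integral.
Qed.

Lemma normal_pdf_scale (s x : R) : (0 < s)%R ->
  (normal_pdf 0 s (s * x) * s = normal_pdf 0 1 x)%R.
Proof.
move=> s0; rewrite !normal_pdfE ?gt_eqF//.
rewrite /normal_peak /normal_fun !subr0 expr1n.
have -> : (- (s * x) ^+ 2 / (s ^+ 2 *+ 2) = - x ^+ 2 / (1 *+ 2))%R.
  have s2 : s != 0%R by rewrite gt_eqF.
  by field.
rewrite mulrAC; congr (_ * _)%R.
rewrite -mulrnAr sqrtrM ?sqr_ge0// sqrtr_sqr gtr0_norm// invfM mul1r.
by rewrite mulrAC mulVf ?mul1r// gt_eqF.
Qed.

(** Substitution x := s x in the density integral; continuity of f is what the
substitution rule on the whole line asks for. *)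
Lemma ge0_integral_normal_law_scale (s : R) (f : R -> R) : (0 < s)%R ->
  (forall x, (0 <= f x)%R) -> continuous f ->
  \int[normal_law 0 s]_x (f x)%:E = \int[normal_law 0 1]_x (f (s * x)%R)%:E.
Proof.
move=> s0 f0 cf.
have cs : continuous (fun x : R => (s * x)%R).
  by move=> x; apply: cvgM; [exact: cvg_cst|exact: cvg_id].
have mf : measurable_fun [set: R] f by exact: continuous_measurable_fun.
have ds x : derivable (fun x : R => (s * x)%R) x 1 by [].
have dsE : ((fun x : R => (s * x)%R)^`())%classic = cst s.
  by apply/funext => x; rewrite derive1Ml// derive1_id mulr1.
have mfs : measurable_fun [set: R] (fun x => f (s * x)%R).
  apply: continuous_measurable_fun => x.
  by apply: continuous_comp; [exact: cs|exact: cf].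
rewrite (normal_law_density _ f0 mf).
rewrite (normal_law_density _ (fun x => f0 (s * x)%R) mfs).
rewrite (@increasing_ge0_integration_by_substitutionT _ (fun x => s * x)%R).
- apply: eq_integral => x _; rewrite dsE -(normal_pdf_scale x s0).
  by rewrite /= !fctE mulrA.
- by move=> x y xy; rewrite ltr_pM2l.
- by rewrite dsE; move=> ?; exact: cvg_cst.
- by rewrite dsE; exact: is_cvg_cst.
- by rewrite dsE; exact: is_cvg_cst.
- by [].
- by apply: gt0_cvgMrNy => //; exact: cvg_id.
- by apply: gt0_cvgMry => //; exact: cvg_id.
- move=> x; apply: cvgM; first exact: cf.
  by apply: continuous_normal_pdf; rewrite gt_eqF.
- by move=> x; rewrite mulr_ge0// normal_pdf_ge0.
Qed.

(** By symmetry this is twice the integral over the positive half-line, where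
x phi(x) is the derivative of - phi(x), with phi the standard normal density. The
value is therefore 2 phi(0). *)
Lemma normal_law_abs_moment :
  \int[normal_law 0 1]_x `|x|%:E = (Num.sqrt (2 / pi))%:E :> \bar R.
Proof.
rewrite (@normal_law_density 1 (fun x => `|x|%R))//.
have cpdf : continuous (@normal_pdf R 0 1) by apply: continuous_normal_pdf.
have cf : continuous (fun x : R => `|x| * normal_pdf 0 1 x)%R.
  by move=> x; apply: cvgM; [exact: norm_continuous|exact: cpdf].
rewrite ge0_symfun_integralT//; last 2 first.
- by move=> x; rewrite mulr_ge0// normal_pdf_ge0.
- by move=> x /=; rewrite normrN !normal_pdfE// /normal_fun !subr0 sqrrN.
rewrite -set_itvcy.
have dpdf (x : R) : is_derive x 1%R
    (fun x => - normal_pdf 0 1 x)%R (x * normal_pdf 0 1 x)%R.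
  rewrite !normal_pdfE// /normal_fun.
  apply: is_derive_eq.
  rewrite /GRing.scale/= expr1n subr0; set e := expR _; by field.
have peakE : (2 * normal_peak 1 = Num.sqrt (2 / pi) :> R)%R.
  rewrite /normal_peak expr1n mul1r -[(pi *+ 2)%R]mulr_natl !sqrtrM ?ler0n//.
  rewrite sqrtrV ?pi_ge0// invfM mulrA; congr (_ / _)%R.
  rewrite -[X in (X / _ = _)%R](@sqr_sqrtr _ 2) ?ler0n//.
  by rewrite expr2 mulfK// gt_eqF// sqrtr_gt0 ltr0n.
rewrite (@ge0_continuous_FTC2y _ _ (fun x => - normal_pdf 0 1 x)%R 0 0)//.
- rewrite sub0e -EFinN opprK -peakE -EFinM normal_pdfE// /normal_fun subr0.
  by rewrite expr0n/= oppr0 mul0r expR0 mulr1.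
- by move=> x x0; rewrite mulr_ge0// normal_pdf_ge0.
- exact: continuous_subspaceT.
- have -> : (fun x : R => - normal_pdf 0 1 x)%R =
      (fun x => - (normal_peak 1 * expR (- (2^-1 * x ^+ 2))))%R.
    apply/funext => x; rewrite normal_pdfE// /normal_fun subr0 expr1n.
    by rewrite mulNr [(_ / 2)%R]mulrC.
  rewrite -[X in _ --> X]oppr0 -(mulr0 (normal_peak (1 : R))).
  apply: cvgN; apply: cvgM; first exact: cvg_cst.
  apply: (cvg_comp (fun x => 2^-1 * x ^+ 2)%R (fun x => expR (- x))).
    apply: gt0_cvgMry; first by rewrite invr_gt0 ltr0n.
    exact: cvgr_expr2.
  exact: cvgr_expR.
- apply: cvg_at_right_filter; apply: cvgN; exact: cpdf.
- move=> x; rewrite in_itv/= andbT => x0.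
  by rewrite derive1E (derive_val (is_derive := dpdf x)) gtr0_norm.
Qed.

End normal.

(** * Deviation of binomial weights from their mean *)

Section binomial.
Context (R : realType).
Implicit Types (p : R) (m k : nat).

Lemma binomial_pmfS m p k :
  binomial_pmf m.+1 p k.+1 =
  p * binomial_pmf m p k + (1 - p) * binomial_pmf m p k.+1.
Proof.
rewrite /binomial_pmf binS mulrnDr addrC; congr (_ + _).
  by rewrite subSS exprS -!mulrnAr mulrA.
have [km|mk] := ltnP k m.
  rewrite subSS -(subnSK km) [X in _ * X *+ _ = _]exprS mulrnAr.
  by rewrite mulrCA.
by rewrite bin_small// !mulr0n mulr0.
Qed.

Lemma binomial_pmfS0 m p :
  binomial_pmf m.+1 p 0 = (1 - p) * binomial_pmf m p 0.
Proof. by rewrite /binomial_pmf !bin0 !subn0 !mulr1n !mul1r exprS. Qed.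

(** One Bernoulli trial splits off: the expectation of f(N_m + 1) and f(N_m), weighted
by success and failure, is that of f(N_(m+1)). The total mass and the
variance follow from it by induction on m. *)
Lemma sum_binomial_pmfS m p (f : nat -> R) :
  \sum_(k < m.+2) binomial_pmf m.+1 p k * f k =
  \sum_(k < m.+1) binomial_pmf m p k * (p * f k.+1 + (1 - p) * f k).
Proof.
rewrite big_ord_recl/= binomial_pmfS0.
under eq_bigr do rewrite /= /bump /= add1n binomial_pmfS mulrDl.
rewrite big_split/= addrCA.
under [RHS]eq_bigr do rewrite mulrDr.
rewrite big_split/=; congr (_ + _).
  by apply: eq_bigr => i _; ring.
rewrite big_ord_recr/= [X in _ + (_ + X)](_ : _ = 0); last first.
  by rewrite /binomial_pmf bin_small// mulr0n mulr0 mul0r.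
rewrite addr0 [RHS]big_ord_recl/=; congr (_ + _); first ring.
by apply: eq_bigr => i _; rewrite /bump/= add1n; ring.
Qed.

Lemma sum_binomial_pmf m p : \sum_(k < m.+1) binomial_pmf m p k = 1.
Proof.
under eq_bigr do rewrite -[binomial_pmf _ _ _]mulr1.
elim: m => [|m IH].
  by rewrite big_ord1 /binomial_pmf bin0 subnn !mulr1n !mulr1.
rewrite (sum_binomial_pmfS m p (fun=> 1)) -[RHS]IH.
by apply: eq_bigr => i _; ring.
Qed.

Lemma binomial_variance m p :
  \sum_(k < m.+1) binomial_pmf m p k * (k%:R - m%:R * p) ^+ 2 =
  m%:R * p * (1 - p).
Proof.
elim: m => [|m IH]; first by rewrite big_ord1 !mul0r subr0 expr0n/= mulr0.
rewrite (sum_binomial_pmfS m p (fun k => (k%:R - m.+1%:R * p) ^+ 2)).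
under eq_bigr => i _.
  (* With x = i - m p the bracket is p (x + 1 - p)^2 + (1 - p) (x - p)^2, in
     which the terms linear in x cancel. *)
  rewrite (_ : _ * _ = binomial_pmf m p i * (i%:R - m%:R * p) ^+ 2 +
     binomial_pmf m p i * (p * (1 - p))); last first.
    by rewrite -!natr1; ring.
  over.
rewrite big_split/= IH -mulr_suml sum_binomial_pmf -natr1; ring.
Qed.

(** The square of the mean a of |k - m p| is at most the second moment, since their
difference is the mean of (|k - m p| - a)^2. *)
Lemma binomial_abs_deviation m p : 0 <= p <= 1 ->
  \sum_(k < m.+1) binomial_pmf m p k * `|k%:R - m%:R * p| <=
  Num.sqrt (m%:R * p * (1 - p)).
Proof.
move=> p01; have /andP[p0 p1] := p01.
have v0 : 0 <= m%:R * p * (1 - p) by rewrite !mulr_ge0// subr_ge0.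
set s := Num.sqrt _; have s2 : s ^+ 2 = m%:R * p * (1 - p) by rewrite sqr_sqrtr.
set a := \sum_(_ < _) _.
have a0 : 0 <= a.
  by apply: sumr_ge0 => k _; rewrite mulr_ge0// binomial_pmf_ge0.
rewrite -ler_sqr ?nnegrE ?sqrtr_ge0// s2 -binomial_variance -subr_ge0.
have -> : \sum_(k < m.+1) binomial_pmf m p k * (k%:R - m%:R * p) ^+ 2 - a ^+ 2 =
  \sum_(k < m.+1) binomial_pmf m p k * (`|k%:R - m%:R * p| - a) ^+ 2.
  under [RHS]eq_bigr => k _.
    rewrite (_ : _ * _ = binomial_pmf m p k * (k%:R - m%:R * p) ^+ 2 +
      (binomial_pmf m p k * `|k%:R - m%:R * p| * (- (2 * a)) +
       binomial_pmf m p k * a ^+ 2)); last first.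
      by rewrite -[(_ - _ * p) ^+ 2]real_normK ?num_real//; ring.
    over.
  by rewrite !big_split/= -!mulr_suml sum_binomial_pmf -/a; ring.
by apply: sumr_ge0 => k _; rewrite mulr_ge0 ?sqr_ge0// binomial_pmf_ge0.
Qed.

Lemma sqrt_sub1_le (x : R) : 0 <= x -> `|Num.sqrt x - 1| <= `|x - 1|.
Proof.
move=> x0.
have -> : x - 1 = (Num.sqrt x - 1) * (Num.sqrt x + 1).
  by rewrite -subr_sqr expr1n sqr_sqrtr.
by rewrite normrM ler_peMr// ger0_norm ?lerDr ?addr_ge0 ?sqrtr_ge0.
Qed.

Lemma binomial_sqrt_deviation m p : (0 < m)%N -> 0 < p <= 1 ->
  \sum_(k < m.+1) binomial_pmf m p k * `|Num.sqrt (k%:R / (m%:R * p)) - 1| <=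
  Num.sqrt (1 - p) / Num.sqrt (m%:R * p).
Proof.
move=> m0 /andP[p0 p1].
have mp0 : 0 < m%:R * p by rewrite mulr_gt0// ltr0n.
have p01 : 0 <= p <= 1 by rewrite ltW.
apply: (@le_trans _ _ ((\sum_(k < m.+1)
    binomial_pmf m p k * `|k%:R - m%:R * p|) / (m%:R * p))).
  rewrite mulr_suml ler_sum// => k _; rewrite -mulrA ler_wpM2l ?binomial_pmf_ge0//.
  apply: le_trans (sqrt_sub1_le _) _; first by rewrite divr_ge0// ltW.
  rewrite -[X in _ <= _ / X](gtr0_norm mp0) -normf_div mulrBl divff ?gt_eqF//.
rewrite -[X in _ / X](sqr_sqrtr (ltW mp0)) expr2 invfM mulrA.
rewrite ler_pM2r ?invr_gt0 ?sqrtr_gt0//.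
rewrite ler_pdivrMr ?sqrtr_gt0// -sqrtrM ?subr_ge0// [X in _ <= Num.sqrt X]mulrC.
by rewrite binomial_abs_deviation.
Qed.

End binomial.

(** * Lipschitz test functions and mixtures *)

Section lipschitz.
Context (R : realType).
Implicit Types (h : R -> R) (mu : probability R R).

Lemma lipschitz1P h : 1.-lipschitz h <-> forall x y, `|h x - h y| <= `|x - y|.
Proof.
split=> [hL x y|hL [x y] _/=]; last by rewrite mul1r hL.
by have := hL (x, y) (conj I I); rewrite /= mul1r.
Qed.

Lemma lipschitz1_continuous h : 1.-lipschitz h -> continuous h.
Proof.
move=> /lipschitz1P hL x; apply/cvgrPdist_lt => e e0.
near=> y; apply: le_lt_trans (hL x y) _.
by near: y; exact: cvgr_dist_lt.
Unshelve. all: by end_near. Qed.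

Lemma lipschitz1_measurable h : 1.-lipschitz h -> measurable_fun [set: R] h.
Proof. by move/lipschitz1_continuous/continuous_measurable_fun. Qed.

Local Open Scope ereal_scope.

(** The domination |h(x)| <= |h(0)| + |x| reduces every integrability question about
test functions to a first moment. *)
Lemma lipschitz1_integrable d (T : measurableType d) (P : probability T R)
    (X : T -> R) h :
  1.-lipschitz h -> P.-integrable setT (EFin \o X) ->
  P.-integrable setT (EFin \o (h \o X)).
Proof.
move=> hL iX.
have mX : measurable_fun setT X.
  by apply/measurable_EFinP; exact: measurable_int iX.
have ic : P.-integrable setT (EFin \o cst `|h 0%R|%R).
  exact: finite_measure_integrable_cst.
apply: (le_integrable measurableT _ _
  (integrableD measurableT ic (integrable_abse iX))).
  apply/measurable_EFinP; apply: measurableT_comp => //.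
  exact: lipschitz1_measurable.
move=> x _ /=; rewrite lee_fin [leRHS]ger0_norm ?addr_ge0//.
rewrite -lerBlDl (le_trans (lerB_dist _ _))//.
by have /lipschitz1P/(_ (X x) 0%R) := hL; rewrite subr0.
Qed.

End lipschitz.

Section mixture.
Context d (T : measurableType d) (R : realType).
Local Open Scope ereal_scope.

(** For nonnegative functions the integral is additive in the measure; integrability
against every component lets the positive and negative parts be recombined. *)
Lemma integral_mixture (n : nat) (w : nat -> R) (mu : probability T R)
    (nu : nat -> probability T R) (f : T -> R) :
  (forall k, 0 <= w k)%R ->
  (forall A, measurable A -> mu A = \sum_(k < n) (w k)%:E * nu k A) ->
  measurable_fun setT f ->
  (forall k, (nu k).-integrable setT (EFin \o f)) ->
  \int[mu]_x (f x)%:E = \sum_(k < n) (w k)%:E * \int[nu k]_x (f x)%:E.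
Proof.
move=> w0 muE /measurable_EFinP mf nuf.
have ge0 (g : T -> \bar R) : (forall x, 0 <= g x) -> measurable_fun setT g ->
    \int[mu]_x g x = \sum_(k < n) (w k)%:E * \int[nu k]_x g x.
  move=> g0 mg.
  pose m_ k : {measure set T -> \bar R} := mscale (NngNum (w0 k)) (nu k).
  rewrite (eq_measure_integral (msum m_ n)); last first.
    by move=> A mA _; exact: muE.
  rewrite ge0_integral_measure_sum//; apply: eq_bigr => k _.
  by rewrite ge0_integral_mscale.
rewrite integralE !ge0//; [|exact: measurable_funeneg|exact: measurable_funepos].
rewrite -fin_num_sumeN; last first.
  move=> k _; rewrite fin_numM//.
  exact: (integrable_neg_fin_num measurableT (nuf k)).
rewrite -big_split/=; apply: eq_bigr => k _.
have pk := integrable_pos_fin_num measurableT (nuf k).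
rewrite [X in _ = _ * X](@integralE _ _ _ (nu k) setT (EFin \o f)).
rewrite [RHS]muleBr//.
exact: fin_num_adde_defr.
Qed.

End mixture.

(** * The law of a random sum *)

Section random_sum_law.
Context d (T : measurableType d) (R : realType) (P : probability T R).
Context (X : nat -> {RV P >-> R}).

(** The sum is measurable for the sigma-algebra generated by the family because each
summand is; this is the event to which independence from N applies. *)
Lemma scaled_sum_sigma_of_family a n (A : set R) : measurable A ->
  sigma_of_family X (scaled_sum a (fun j : 'I_n => X j) @^-1` A).
Proof.
set G := \bigcup_(i in [set: nat]) preimage_set_system setT (X i) measurable.
have mX j : measurable_fun [set: g_sigma_algebraType G] (X j : _ -> R).
  move=> _ B mB; apply: sub_gen_smallest; exists j => //.
  by exists B.
have mS : measurable_fun [set: g_sigma_algebraType G]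
    (scaled_sum a (fun j : 'I_n => X j) : _ -> R).
  apply: measurable_funM; first exact: measurable_cst.
  by apply: measurable_sum => j; exact: mX.
by move=> mA; rewrite -[X in sigma_of_family _ X]setTI; exact: mS.
Qed.

Local Open Scope ereal_scope.

Lemma binomial_prob1 m (p : R) k : (0 <= p <= 1)%R ->
  binomial_prob m p [set k] = (binomial_pmf m p k)%:E.
Proof.
by move=> p01; rewrite /binomial_prob p01 esum_set1// lee_fin binomial_pmf_ge0.
Qed.

Lemma binomial_prob_gt m (p : R) :
  (0 <= p <= 1)%R -> binomial_prob m p (~` `I_m.+1) = 0.
Proof.
move=> p01; rewrite /binomial_prob p01 esum1// => k /= /negP.
by rewrite -leqNgt => mk; rewrite /binomial_pmf bin_small// mulr0n.
Qed.

(** The event is cut along the values of N. The values k <= m give a disjoint union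
on whose pieces independence factors the probability; N > m has probability
zero. *)
Lemma scaled_random_sum_law a (N : {RV P >-> nat}) m (p : R) A :
  (0 <= p <= 1)%R ->
  same_law (distribution P N) (binomial_prob m p) ->
  independent_of_family N X -> measurable A ->
  distribution P (scaled_random_sum a N X) A =
  \sum_(k < m.+1) (binomial_pmf m p k)%:E *
    distribution P (scaled_sum a (fun j : 'I_k => X j)) A.
Proof.
move=> p01 NE NX mA.
pose S k := scaled_sum a (fun j : 'I_k => X j).
have mN B : measurable (N @^-1` B).
  by rewrite -[X in measurable X]setTI; exact: measurable_funP.
have mSA k : measurable (S k @^-1` A).
  by rewrite -[X in measurable X]setTI; exact: measurable_scaled_sum.
have mWA : measurable (scaled_random_sum a N X @^-1` A).
  by rewrite -[X in measurable X]setTI; exact: measurable_scaled_random_sum.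
rewrite /distribution /pushforward.
pose F k := N @^-1` [set k] `&` S k @^-1` A.
have FE k : P (F k) = (binomial_pmf m p k)%:E * P (S k @^-1` A).
  rewrite NX//; last exact: scaled_sum_sigma_of_family.
  by rewrite -binomial_prob1// -NE.
under eq_bigr do rewrite -FE.
rewrite -(@measure_bigsetU _ _ _ P F); last 2 first.
- by move=> k; exact: measurableI.
- by move=> i j _ _ [w [[/= <- _] [/= <- _]]].
set W := scaled_random_sum _ _ _ @^-1` _.
have -> : \big[setU/set0]_(k < m.+1) F k = W `&` N @^-1` `I_m.+1.
  rewrite -bigcup_mkord; apply/seteqP; split.
    move=> w [k /= km [/= Nk SA]]; split; rewrite /= ?Nk//.
    by rewrite /W /scaled_random_sum/= Nk.
  by move=> w [Ww Nm]; exists (N w).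
apply/eqP; rewrite eq_le; apply/andP; split; last first.
  by rewrite le_measure ?inE//; exact: measurableI.
apply: (@le_trans _ _ (P (W `&` N @^-1` `I_m.+1 `|` N @^-1` (~` `I_m.+1)))).
  rewrite le_measure ?inE//.
    apply: measurableU => //; exact: measurableI.
  by move=> w Ww; have [?|?] := pselect (`I_m.+1 (N w)); [left|right].
apply: le_trans (measureU2 _ _ _) _ => //; first exact: measurableI.
rewrite [X in _ + X](_ : _ = 0) ?adde0//.
by rewrite -(binomial_prob_gt m p01) -NE.
Qed.

End random_sum_law.

(** * Dilations and the Wasserstein distance *)

Section wasserstein_scaling.
Context (R : realType).
Implicit Types (h : R -> R) (mu nu : probability R R).
Local Open Scope ereal_scope.

Lemma lipschitz1_scale h (c : R) : (0 < c)%R -> 1.-lipschitz h ->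
  1.-lipschitz (fun x => c^-1 * h (c * x))%R.
Proof.
move=> c0 /lipschitz1P hL; apply/lipschitz1P => x y.
rewrite -mulrBr normrM gtr0_norm ?invr_gt0// ler_pdivrMl//.
by rewrite (le_trans (hL _ _))// -mulrBr normrM gtr0_norm.
Qed.

Lemma lipschitz1_scale_integrable d (T : measurableType d)
    (P : probability T R) (X : T -> R) h (c : R) : 1.-lipschitz h ->
  P.-integrable setT (EFin \o X) ->
  P.-integrable setT (fun x => (h (c * X x)%R)%:E).
Proof.
move=> hL iX; apply: (@lipschitz1_integrable _ _ _ P (fun x => c * X x)%R h) => //.
rewrite (_ : _ \o _ = (fun x => c%:E * (EFin \o X) x))//.
exact: integrableZl.
Qed.

(** If h is 1-Lipschitz, so is x |-> h(c x) / c: the dilated difference is c times one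
of the differences in the supremum. *)
Lemma wasserstein_scale mu nu h (c : R) : (0 < c)%R -> 1.-lipschitz h ->
  mu.-integrable setT EFin -> nu.-integrable setT EFin ->
  `| \int[mu]_x (h (c * x)%R)%:E - \int[nu]_x (h (c * x)%R)%:E | <=
  c%:E * wasserstein mu nu.
Proof.
move=> c0 hL imu inu.
have ZE (rho : probability R R) : rho.-integrable setT EFin ->
    \int[rho]_x (h (c * x)%R)%:E =
    c%:E * \int[rho]_x (c^-1 * h (c * x))%:E :> \bar R.
  move=> irho.
  have i := @lipschitz1_integrable _ _ _ rho idfun _
    (lipschitz1_scale c0 hL) irho.
  rewrite -(integralZl measurableT i).
  by apply: eq_integral => x _; rewrite -EFinM mulVKf// gt_eqF.
have fn (rho : probability R R) : rho.-integrable setT EFin ->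
    \int[rho]_x (c^-1 * h (c * x))%:E \is a fin_num.
  move=> irho; apply: integrable_fin_num => //.
  exact: (@lipschitz1_integrable _ _ _ rho idfun _ (lipschitz1_scale c0 hL)).
rewrite !ZE// -muleBr//; last by rewrite fin_num_adde_defr// fn.
rewrite abseM gee0_abs; last by rewrite lee_fin ltW.
rewrite lee_pmul2l ?lte_fin//; apply: ereal_sup_ubound.
by exists (fun x => c^-1 * h (c * x))%R => //; exact: lipschitz1_scale.
Qed.

Lemma normal_law_integrable_id : (normal_law 0 (1 : R)).-integrable setT EFin.
Proof.
apply/integrableP; split; first exact/measurable_EFinP.
by rewrite normal_law_abs_moment ltry.
Qed.

(** The scaling identity for nonnegative functions, applied to the positive and the
negative part of h, which are again continuous. *)
Lemma integral_normal_law_scale (s : R) h : (0 < s)%R -> continuous h ->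
  \int[normal_law 0 s]_x (h x)%:E = \int[normal_law 0 1]_x (h (s * x)%R)%:E.
Proof.
move=> s0 ch.
have maxE (g : R -> R) : continuous g ->
    \int[normal_law 0 s]_x (Num.max (g x) 0)%:E =
    \int[normal_law 0 1]_x (Num.max (g (s * x)%R) 0)%:E.
  move=> cg.
  apply: (@ge0_integral_normal_law_scale _ s (fun x => Num.max (g x) 0%R)) => //.
    by move=> x; rewrite le_max lexx orbT.
  by move=> x; apply: continuous_max; [exact: cg|exact: cst_continuous].
have splitE (mu : probability R R) (g : R -> R) : \int[mu]_x (g x)%:E =
    \int[mu]_x (Num.max (g x) 0)%:E - \int[mu]_x (Num.max (- g x) 0)%:E.
  rewrite integralE; congr (_ - _); apply: eq_integral => x _.
    by rewrite funeposE EFin_max.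
  by rewrite funenegE EFin_max.
have cNh : continuous (fun x => - h x)%R.
  by move=> x; apply: continuousN; exact: ch.
apply: (eq_trans (splitE _ h)).
apply: (eq_trans _ (esym (splitE _ (fun x => h (s * x)%R)))).
by rewrite (maxE h ch) (maxE _ cNh).
Qed.

(** Both integrals are taken over the same normal variable, so the integrands can be
compared pointwise: |h(b x) - h(c x)| <= |b - c| |x|. *)
Lemma normal_law_lipschitz_scale h (b c : R) : 1.-lipschitz h ->
  `| \int[normal_law 0 1]_x (h (b * x)%R)%:E -
     \int[normal_law 0 1]_x (h (c * x)%R)%:E | <=
  (`|b - c| * Num.sqrt (2 / pi))%:E.
Proof.
move=> hL.
have ih a := lipschitz1_scale_integrable a hL normal_law_integrable_id.
rewrite -integralB_EFin; [|exact: measurableT|exact: (ih b)|exact: (ih c)].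
apply: le_trans (le_abse_integral _ _ _) _ => //.
  apply: (measurable_int (normal_law 0 (1 : R))).
  exact: (integrableB measurableT (ih b) (ih c)).
rewrite EFinM -normal_law_abs_moment -ge0_integralZl//; last first.
  by apply/measurable_EFinP; exact: continuous_measurable_fun norm_continuous.
apply: ge0_le_integral => //.
- apply: measurableT_comp => //.
  apply: (measurable_int (normal_law 0 (1 : R))).
  exact: (integrableB measurableT (ih b) (ih c)).
- apply: emeasurable_funM => //; apply/measurable_EFinP.
  exact: continuous_measurable_fun norm_continuous.
move=> x _; rewrite -EFinB abse_EFin -EFinM lee_fin.
have /lipschitz1P/(_ (b * x)%R (c * x)%R) := hL.
by rewrite -mulrBl normrM.
Qed.

End wasserstein_scaling.

(** * Normalized sums of independent and identically distributed variables *)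

Lemma integral_probability_cst d (T : measurableType d) (R : realType)
    (P : probability T R) (c : R) : (\int[P]_x c%:E = c%:E)%E.
Proof. by rewrite integral_cst// [X in (_ * X)%E](probability_setT P) mule1. Qed.

Section identically_distributed.
Context d (T : measurableType d) (R : realType) (P : probability T R).
Implicit Types (X Y : {RV P >-> R}).
Local Open Scope ereal_scope.

Lemma ge0_expectation_same_law X Y (f : R -> R) :
  same_law (distribution P X) (distribution P Y) ->
  measurable_fun setT f -> (forall x, (0 <= f x)%R) ->
  'E_P[fun w => f (X w)] = 'E_P[fun w => f (Y w)].
Proof.
move=> XY /measurable_EFinP mf f0.
have {}f0 x : 0 <= (EFin \o f) x by rewrite lee_fin.
rewrite unlock.
rewrite -(ge0_integral_distribution X mf f0) -(ge0_integral_distribution Y mf f0).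
by apply: eq_measure_integral => A mA _; exact: XY.
Qed.

Lemma expectation_same_law X Y :
  same_law (distribution P X) (distribution P Y) ->
  P.-integrable setT (EFin \o X) -> P.-integrable setT (EFin \o Y) ->
  'E_P[X] = 'E_P[Y].
Proof.
move=> XY iX iY.
have mE : measurable_fun [set: R] EFin by exact/measurable_EFinP.
rewrite unlock -(integral_distribution mE iX) -(integral_distribution mE iY).
by apply: eq_measure_integral => A mA _; exact: XY.
Qed.

(** |x| <= 1 + x^2. *)
Lemma integrable_of_sqr X :
  'E_P[fun w => (X w ^+ 2)%R] < +oo -> P.-integrable setT (EFin \o X).
Proof.
move=> X2.
have i2 : P.-integrable setT (fun w => (X w ^+ 2)%:E).
  apply/integrableP; split; first exact/measurable_EFinP/measurable_funX.
  move: X2; rewrite unlock.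
  by under eq_integral do rewrite -[(_ ^+ 2)%R]ger0_norm ?sqr_ge0//.
have i1 : P.-integrable setT (EFin \o cst 1%R).
  exact: finite_measure_integrable_cst.
apply: (le_integrable measurableT _ _ (integrableD measurableT i1 i2)).
  exact/measurable_EFinP.
move=> w _ /=; rewrite lee_fin [leRHS]ger0_norm ?addr_ge0 ?sqr_ge0//.
rewrite -real_normK ?num_real//; have [x1|/ltW x1] := leP `|X w|%R 1%R.
  by apply: le_trans x1 _; rewrite lerDl sqr_ge0.
by apply: (@le_trans _ _ (`|X w| ^+ 2)%R); [exact: ler_eXnr|rewrite lerDr].
Qed.

Lemma scaled_sum_integrable a n (Y : 'I_n -> {RV P >-> R}) :
  (forall j, P.-integrable setT (EFin \o Y j)) ->
  P.-integrable setT (EFin \o scaled_sum a Y).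
Proof.
move=> iY; rewrite (_ : _ \o _ = (fun w => a%:E * \sum_(j < n) (EFin \o Y j) w)).
  by apply: integrableZl => //; exact: integrable_sum.
by apply/funext => w; rewrite /= sumEFin.
Qed.

(** The product rule over a list of ordinals is the one over their values, with the
full space attached to every index n or larger. *)
Lemma mutually_independent_widen (X : nat -> {RV P >-> R}) n :
  mutually_independent X -> mutually_independent (fun j : 'I_n => X j).
Proof.
move=> iX s A us mA.
pose A' i := oapp A setT (insub i : option 'I_n).
have A'E (j : 'I_n) : A' j = A j by rewrite /A' valK.
have mA' i : measurable (A' i).
  by rewrite /A'; case: insubP => [j _ _|_] /=; [exact: mA|exact: measurableT].
have us' : uniq (map val s) by rewrite map_inj_uniq//; exact: val_inj.
have := iX _ A' us' mA'.
rewrite big_map; under eq_bigr do rewrite A'E.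
move=> <-; congr (P _); apply/seteqP; split => w Xw i /=.
  by move=> /mapP[j js ->]; rewrite A'E; exact: Xw.
by move=> is_; have /= := Xw (val i); rewrite A'E; apply; exact: map_f.
Qed.

End identically_distributed.

Section berry_esseen_iid.
Context (R : realType) (CW : R) (hCW : berry_esseen_wasserstein_constant CW).
Context d (T : measurableType d) (P : probability T R).
Context (X : nat -> {RV P >-> R}) (sigma xi : R).
Context (X_indep : mutually_independent X)
  (X_ident : forall j,
    same_law (distribution P (X j)) (distribution P (X 0%N)))
  (X_mean : ('E_P[X 0%N] = 0)%E)
  (sigma_gt0 : 0 < sigma)
  (X_var : ('E_P[fun w => (X 0%N w ^+ 2)%R] = (sigma ^+ 2)%:E)%E)
  (X_third : ('E_P[fun w => (`|X 0%N w| ^+ 3)%R] = xi%:E)%E).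
Local Open Scope ereal_scope.

Lemma iid_var j : 'E_P[fun w => (X j w ^+ 2)%R] = (sigma ^+ 2)%:E.
Proof.
rewrite -X_var; apply: (ge0_expectation_same_law (f := fun x => x ^+ 2)%R) => //.
by move=> x; rewrite sqr_ge0.
Qed.

Lemma iid_third j : 'E_P[fun w => (`|X j w| ^+ 3)%R] = xi%:E.
Proof.
rewrite -X_third.
apply: (ge0_expectation_same_law (f := fun x => `|x| ^+ 3)%R) => //.
by apply: measurable_funX; exact: continuous_measurable_fun norm_continuous.
Qed.

Lemma iid_integrable j : P.-integrable setT (EFin \o X j).
Proof. by apply: integrable_of_sqr; rewrite iid_var ltry. Qed.

Lemma iid_mean j : 'E_P[X j] = 0.
Proof.
by rewrite -X_mean; apply: expectation_same_law => //; exact: iid_integrable.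
Qed.

Lemma wasserstein_normalized_sum n : (0 < n)%N ->
  wasserstein
    (distribution P (scaled_sum (sigma * Num.sqrt n%:R)^-1 (fun j : 'I_n => X j)))
    (normal_law 0 1) <=
  (CW * (sigma * Num.sqrt n%:R) ^- 3 * (n%:R * xi))%:E.
Proof.
move=> n0.
have sum_cst c : \sum_(j < n) c%:E = (n%:R * c)%:E :> \bar R.
  by rewrite sumEFin sumr_const card_ord mulr_natl.
have := @hCW _ T P n (fun j => X j) n0 (mutually_independent_widen X_indep)
  (fun j => iid_mean j).
move=> /(_ (fun j => _)) /=.
rewrite (eq_bigr (fun=> (sigma ^+ 2)%:E)) => [|j _]; last exact: iid_var.
rewrite [X in (_ -> _ -> _ <= _ * X)](eq_bigr (fun=> xi%:E)) => [|j _];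
  last exact: iid_third.
rewrite !sum_cst /= sqrtrM ?ler0n// sqrtr_sqr gtr0_norm// mulrC -EFinM; apply.
- by move=> j; rewrite iid_var lte_fin exprn_gt0.
- by move=> j; rewrite iid_third ltry.
Qed.

(** a S_n is S_n / B dilated by a B, where B = sigma sqrt n. Dilation multiplies the
Berry-Esseen bound CW n xi / B^3 by a B, which leaves a bound free of n. *)
Lemma scaled_sum_normal_approx_gt0 (a : R) n (h : R -> R) :
  (0 < n)%N -> (0 < a)%R ->
  1.-lipschitz h ->
  `| \int[distribution P (scaled_sum a (fun j : 'I_n => X j))]_x (h x)%:E -
     \int[normal_law 0 1]_x (h (a * (sigma * Num.sqrt n%:R) * x)%R)%:E | <=
  (a * (CW * xi / sigma ^+ 2))%:E.
Proof.
move=> n0 a0 hL.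
set B := (sigma * Num.sqrt n%:R)%R.
have B0 : (0 < B)%R by rewrite mulr_gt0// sqrtr_gt0 ltr0n.
have iS b : P.-integrable setT (EFin \o scaled_sum b (fun j : 'I_n => X j)).
  by apply: scaled_sum_integrable => j; exact: iid_integrable.
have mE : measurable_fun [set: R] EFin by exact/measurable_EFinP.
have -> : \int[distribution P (scaled_sum a (fun j : 'I_n => X j))]_x (h x)%:E =
    \int[distribution P (scaled_sum B^-1 (fun j : 'I_n => X j))]_x
      (h (a * B * x)%R)%:E.
  have mh : measurable_fun setT (EFin \o h).
    by apply/measurable_EFinP; exact: lipschitz1_measurable.
  have ih := lipschitz1_integrable hL (iS a).
  have ihB := lipschitz1_scale_integrable (a * B)%R hL (iS B^-1%R).
  have mhB : measurable_fun setT (fun x => (h (a * B * x)%R)%:E).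
    apply/measurable_EFinP/measurableT_comp; first exact: lipschitz1_measurable.
    exact: mulrl_measurable.
  rewrite (integral_distribution mh ih) (integral_distribution mhB ihB).
  apply: eq_integral => w _ /=; congr (h _)%:E.
  by rewrite /scaled_sum mulrA mulfK// gt_eqF.
apply: le_trans (wasserstein_scale _ hL _ _) _.
- by rewrite mulr_gt0.
- apply: integrable_pushforward => //; exact: iS.
- exact: normal_law_integrable_id.
apply: (@le_trans _ _ ((a * B)%:E * (CW * B ^- 3 * (n%:R * xi))%:E)).
  apply: lee_wpmul2l; first by rewrite lee_fin mulr_ge0// ltW.
  exact: wasserstein_normalized_sum.
rewrite -EFinM lee_fin.
(* n = B^2 / sigma^2, so the powers of B cancel. *)
have -> : (a * (CW * xi / sigma ^+ 2) =
    a * B * (CW * B ^- 3 * (B ^+ 2 / sigma ^+ 2 * xi)))%R.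
  by field; rewrite !gt_eqF.
have -> : (B ^+ 2 = sigma ^+ 2 * n%:R)%R by rewrite exprMn sqr_sqrtr ?ler0n.
by rewrite [(sigma ^+ 2 * _)%R]mulrC mulfK// gt_eqF// exprn_gt0.
Qed.

(** For n = 0 both integrals equal h(0). The right-hand side is nonnegative because it
bounds an absolute value when n = 1. *)
Lemma scaled_sum_normal_approx (a : R) n (h : R -> R) : (0 < a)%R ->
  1.-lipschitz h ->
  `| \int[distribution P (scaled_sum a (fun j : 'I_n => X j))]_x (h x)%:E -
     \int[normal_law 0 1]_x (h (a * (sigma * Num.sqrt n%:R) * x)%R)%:E | <=
  (a * (CW * xi / sigma ^+ 2))%:E.
Proof.
move=> a0 hL; case: n => [|n]; last exact: scaled_sum_normal_approx_gt0.
have A0 := le_trans (abse_ge0 _) (scaled_sum_normal_approx_gt0 (ltn0Sn 0) a0 hL).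
have mh : measurable_fun setT (EFin \o h).
  by apply/measurable_EFinP; exact: lipschitz1_measurable.
have iS : P.-integrable setT (EFin \o scaled_sum a (fun j : 'I_0 => X j)).
  by apply: scaled_sum_integrable => j; exact: iid_integrable.
have -> : \int[distribution P (scaled_sum a (fun j : 'I_0 => X j))]_x (h x)%:E =
    (h 0%R)%:E.
  rewrite (integral_distribution mh (lipschitz1_integrable hL iS)).
  under eq_integral do rewrite /= /scaled_sum big_ord0 mulr0.
  exact: integral_probability_cst.
under eq_integral do rewrite sqrtr0 !mulr0 mul0r.
by rewrite integral_probability_cst subee// abse0.
Qed.

End berry_esseen_iid.

(** * The bound for binomial random sums *)

Theorem theorem3p9 (R : realType) (CW : R)
    (hCW : berry_esseen_wasserstein_constant CW)
    (d : measure_display) (T : measurableType d) (P : probability T R)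
    (X : nat -> {RV P >-> R}) (sigma xi : R)
    (X_indep : mutually_independent X)
    (X_ident : forall j, same_law (distribution P (X j)) (distribution P (X 0%N)))
    (X_mean : ('E_P[X 0%N] = 0)%E)
    (sigma_gt0 : 0 < sigma)
    (X_var : ('E_P[fun w => (X 0%N w ^+ 2)%R] = (sigma ^+ 2)%:E)%E)
    (X_third : ('E_P[fun w => (`|X 0%N w| ^+ 3)%R] = xi%:E)%E)
    (m : nat) (m_gt0 : (1 <= m)%N) (p : R) (p01 : 0 < p < 1)
    (N : {RV P >-> nat})
    (N_binomial : same_law (distribution P N) (binomial_prob m p))
    (N_indep : independent_of_family N X) :
  (wasserstein
     (distribution P (scaled_random_sum (Num.sqrt (m%:R * p))^-1 N X))
     (normal_law 0 sigma)
   <= ((CW * xi / sigma ^+ 2 + sigma * Num.sqrt (2 * (1 - p) / pi))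
       * (Num.sqrt (m%:R * p))^-1)%:E)%E.
Proof.
have /andP[p0 p1] := p01.
have p01' : 0 <= p <= 1 by rewrite !ltW.
have mp0 : 0 < m%:R * p by rewrite mulr_gt0// ltr0n.
set a : R := (Num.sqrt (m%:R * p))^-1.
have a0 : 0 < a by rewrite invr_gt0 sqrtr_gt0.
apply: ge_ereal_sup => _ [h hL <-].
pose nu k : probability R R := distribution P (scaled_sum a (fun j : 'I_k => X j)).
pose M k := (\int[nu k]_x (h x)%:E)%E.
pose g b := (\int[normal_law 0 1]_x (h (b * x)%R)%:E)%E.
have w0 k : 0 <= binomial_pmf m p k by exact: binomial_pmf_ge0.
have inu k : (nu k).-integrable setT (EFin \o h).
  apply: integrable_pushforward => //.
  - by apply/measurable_EFinP; exact: lipschitz1_measurable.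
  - apply: (lipschitz1_integrable hL); apply: scaled_sum_integrable => j.
    exact: (iid_integrable X_ident X_var).
have gfin b : g b \is a fin_num.
  apply: integrable_fin_num => //.
  exact: (lipschitz1_scale_integrable b hL (normal_law_integrable_id R)).
have Mfin k : M k \is a fin_num by apply: integrable_fin_num => //; exact: inu.
have mh : measurable_fun setT h := lipschitz1_measurable hL.
rewrite (integral_mixture w0 (fun A mA =>
  scaled_random_sum_law a p01' N_binomial N_indep mA) mh inu).
rewrite (integral_normal_law_scale sigma_gt0 (lipschitz1_continuous hL)).
pose b k := a * (sigma * Num.sqrt k%:R).
have MG k : `|fine (M k) - fine (g sigma)| <= a * (CW * xi / sigma ^+ 2) +
    `|Num.sqrt (k%:R / (m%:R * p)) - 1| * (sigma * Num.sqrt (2 / pi)).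
  rewrite -(subrKA (fine (g (b k)))); apply: le_trans (ler_normD _ _) _.
  rewrite lerD//.
    rewrite -lee_fin -abse_EFin EFinB !fineK//.
    exact: (scaled_sum_normal_approx hCW X_indep X_ident X_mean).
  have := normal_law_lipschitz_scale (b k) sigma hL.
  rewrite -/(g _) -/(g _) -(fineK (gfin (b k))) -(fineK (gfin sigma)).
  rewrite -EFinB abse_EFin lee_fin => /le_trans; apply.
  rewrite mulrA ler_wpM2r//.
  have -> : b k - sigma = (Num.sqrt (k%:R / (m%:R * p)) - 1) * sigma.
    by rewrite sqrtrM ?ler0n// sqrtrV ?ltW// /b /a; ring.
  by rewrite normrM (gtr0_norm sigma_gt0).
under eq_bigr do rewrite -/(M _) -(fineK (Mfin _)) -EFinM.
rewrite -/(g sigma) -(fineK (gfin sigma)) sumEFin -EFinB abse_EFin lee_fin.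
(* The weights sum to one, so the constant E h(sigma Z) is also their average. *)
rewrite -[fine (g sigma)]mul1r -(sum_binomial_pmf m p) mulr_suml -sumrB.
apply: le_trans (ler_norm_sum _ _ _) _.
apply: (@le_trans _ _ (\sum_(k < m.+1)
    (binomial_pmf m p k * (a * (CW * xi / sigma ^+ 2)) +
     binomial_pmf m p k * `|Num.sqrt (k%:R / (m%:R * p)) - 1| *
       (sigma * Num.sqrt (2 / pi))))).
  apply: ler_sum => k _; rewrite -mulrBr normrM ger0_norm//.
  rewrite -(mulrA _ `|Num.sqrt _ - 1|) -mulrDr.
  by rewrite ler_wpM2l.
rewrite big_split/= -!mulr_suml sum_binomial_pmf mul1r [leRHS]mulrDl lerD//.
  by rewrite mulrC.
have s0 : 0 <= sigma * Num.sqrt (2 / pi) by rewrite mulr_ge0// ltW.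
apply: le_trans (ler_wpM2r s0 (binomial_sqrt_deviation _ _)) _ => //.
  by rewrite p0 ltW.
rewrite [2 * _ / _]mulrAC [Num.sqrt (2 / pi * _)]sqrtrM ?divr_ge0 ?pi_ge0//.
by rewrite le_eqVlt; apply/orP; left; apply/eqP; rewrite /a; ring.
Qed.
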